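(* Let $r$ be a positive integer. There are constants $c,C>0$ (depending only on $r$) such that for $G\sim\mathcal{G}(n,p)$ with $p=p(n)$: (a) if $p<\left(\frac{c\log n}{n}\right)^{\sqrt{r}/2^{r-2}}$, then w.h.p. $\mathrm{tc}_r(G)>r$; and (b) if $p>\left(\frac{C\log n}{n}\right)^{1/2^{r}}$, then w.h.p. $\mathrm{tc}_r(G)\le r$.
   Context: $\mathcal{G}(n,p)$ is the binomial random graph on $n$ vertices, in which each pair of vertices is an edge independently with probability $p=p(n)$. ''W.h.p.'' means with probability tending to $1$ as $n\to\infty$. $\log$ is the natural logarithm. For a graph $G$, $\mathrm{tc}_r(G)$ is the minimum $m$ such that for every colouring of the edges of $G$ with $r$ colours there is a collection of at most $m$ monochromatic trees in $G$ (subgraphs that are trees all of whose edges have the same colour; a single vertex counts as a monochromatic tree) that together cover all vertices of $G$. Trees may overlap. Equivalently, ''tree'' may be replaced by ''monochromatic connected component'', i.e. a connected component of the spanning subgraph formed by the edges of one colour (singleton components allowed). *)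

(* Defs.v *)
From mathcomp Require Import all_boot all_order all_algebra.
From mathcomp Require Import boolp.
Set Implicit Arguments. Unset Strict Implicit. Unset Printing Implicit Defensive.
Import Order.TTheory GRing.Theory Num.Theory.
Local Open Scope ring_scope.

(* A graph on T is identified with its edge set, a subset of [pairs T]. *)
Definition pairs (T : finType) : {set {set T}} := [set e : {set T} | #|e| == 2].

Definition adj (T : finType) (E : {set {set T}}) : rel T :=
  fun x y => (x != y) && ([set x; y] \in E).

(* In a pair (V, E), V is a vertex set and E an edge set. *)
Definition subgraph (T : finType) (G : {set {set T}})
    (H : {set T} * {set {set T}}) : Prop :=
  H.2 \subset G /\ (forall e, e \in H.2 -> e \subset H.1).

Definition connected_graph (T : finType) (H : {set T} * {set {set T}}) : Prop :=
  H.1 != set0 /\ {in H.1 &, forall x y, connect (adj H.2) x y}.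

(* Every edge xy yields the [ucycle] [:: x; y], so only sequences of at least
   three distinct vertices are genuine cycles. *)
Definition acyclic_graph (T : finType) (H : {set T} * {set {set T}}) : Prop :=
  forall s : seq T, (2 < size s)%N -> ~ ucycle (adj H.2) s.

Definition tree (T : finType) (H : {set T} * {set {set T}}) : Prop :=
  connected_graph H /\ acyclic_graph H.

(* Colourings are total on {set T}; only their values on edges matter. *)
Definition monochromatic (T : finType) (r : nat) (c : {set T} -> 'I_r)
    (H : {set T} * {set {set T}}) : Prop :=
  {in H.2 &, forall e f, c e = c f}.

Definition tree_coverable (T : finType) (r : nat) (G : {set {set T}})
    (m : nat) : Prop :=
  forall c : {set T} -> 'I_r,
  exists F : {set {set T} * {set {set T}}},
  [/\ (#|F| <= m)%N,
      forall H, H \in F -> [/\ subgraph G H, tree H & monochromatic c H]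
    & forall v : T, exists2 H, H \in F & v \in H.1].

Lemma tree_coverable_card (T : finType) (r : nat) (G : {set {set T}}) :
  exists m, `[< tree_coverable r G m >].
Proof.
exists #|T|; apply/asboolP => c.
exists [set ([set v], set0) | v : T]; split.
- exact: leq_imset_card.
- move=> H /imsetP[v _ ->]; split.
  + by split=> [|e]; rewrite ?sub0set ?inE.
  + split; first split=> /=.
    * by apply/set0Pn; exists v; rewrite inE.
    * by move=> x y; rewrite !inE => /eqP -> /eqP ->; exact: connect0.
    * by case=> [|x [|y s]] //= _ /andP[/andP[]]; rewrite /adj inE andbF.
  + by move=> e f /=; rewrite inE.
- move=> v; exists ([set v], set0); last by rewrite inE.
  by apply/imsetP; exists v.
Qed.

Definition tc (T : finType) (r : nat) (G : {set {set T}}) : nat :=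
  ex_minn (tree_coverable_card r G).

(* Imported only here: classical_sets would shadow the finset [set0] above. *)
From mathcomp Require Import all_classical all_reals all_analysis.
Import numFieldNormedType.Exports.

Definition gnp_prob (R : realType) (n : nat) (p : R)
    (A : pred {set {set 'I_n}}) : R :=
  \sum_(G in powerset (pairs 'I_n) | A G)
    \prod_(e in pairs 'I_n) (if e \in G then p else 1 - p).

Definition whp (R : realType) (p : nat -> R)
    (A : forall n : nat, pred {set {set 'I_n}}) : Prop :=
  ((fun n => gnp_prob (p n) (A n)) @ \oo --> (1 : R))%classic.

(* Main.v *)
Require Import Defs.
From mathcomp Require Import all_boot all_order all_algebra.
From mathcomp Require Import boolp zify ring lra.
Set Implicit Arguments. Unset Strict Implicit. Unset Printing Implicit Defensive.
Import Order.TTheory GRing.Theory Num.Theory.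
Local Open Scope ring_scope.

(** Both halves compare covers by monochromatic components with a Helly-type
question about [r]-tuples: in a coloured graph, attach to a vertex the tuple of
its components in the [r] colours; two vertices are joined by an edge only if
their tuples agree in some coordinate.

Upper bound.  Put [K = 2 ^ r].  When [p ^ K > C log n / n], with high
probability any [K] vertices have a common neighbour [u]
([prob_no_common_nbr], [prob_tc_le]), so the tuple of [u] agrees somewhere with
each of the [K] tuples.  A vertex set minimal among those whose tuples agree
with no single one is a system of tuples [a_i], [b_j] agreeing somewhere exactly
when [i != j], and such a system has at most [2 ^ r] members
([set_pair_bound]).  Hence one vertex [u] works for the whole graph
([helly_agreement]), and spanning trees of the [r] components of [u] cover it
([common_nbr_coverable]).

Lower bound.  Put [s = r - 1] and [k = 'C(s, s./2)].  If a constant size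
independent set [A] is such that every other vertex has fewer than [k]
neighbours in [A], and more than [r] of them have none, the graph can be
coloured so that [r] trees do not suffice.
The last colour joins the vertices outside [A] to each other.  A vertex of [A]
carries a label: a bit, a set of about [s / 2] of the first [s] colours, and one
of [s + 1] copy indices.  A vertex [u] outside [A] with fewer than [k]
neighbours in [A] can choose a bit for each of these colours such that each
neighbour agrees with [u] on some colour of its set ([label_transversal]); that
colour is given to the edge.  A tree of colour [j < s] then only meets labels
with one common bit whose set contains [j], unless it meets [A] in a single
vertex; [s] trees cannot cover all labels ([label_escape]), and one more tree is
spent on vertices without neighbours in [A] ([sparse_gadget_not_coverable]).

Such an [A] is found among [N] disjoint candidates, where [N] is a small power
of [n].  Their union is independent with high probability because it is so
small.  Each candidate succeeds with probability about
[(1 - 2 ^ |A| p ^ k) ^ n], only a small negative power of [n], independently of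
the other candidates; so some candidate succeeds ([prob_tc_gt],
[tc_gt_error]).  The exponent in the statement comes from
['C(s, s./2) >= 2 ^ (r - 2) / sqrt r] ([middle_bin_ge]). *)

(** * Set pairs and a Helly property of tuples *)

(** The matrix [\prod_k (b j k - a i k)] is diagonal with nonzero diagonal, so
its rank is [m]; expanding the product over the subsets of ['I_r] factors it
through a space of dimension [2 ^ r]. *)
Lemma set_pair_bound (r m : nat) (a b : 'I_m -> 'I_r -> rat) :
  (forall i j, (exists k, a i k = b j k) <-> i != j) -> (m <= 2 ^ r)%N.
Proof.
move=> hab.
pose M : 'M[rat]_m := \matrix_(i, j) \prod_k (b j k - a i k).
pose A : 'M[rat]_(m, #|{set 'I_r}|) :=
  \matrix_(i, s) \prod_k (if k \in (enum_val s : {set 'I_r}) then 1 else - a i k).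
pose B : 'M[rat]_(#|{set 'I_r}|, m) :=
  \matrix_(s, j) \prod_k (if k \in (enum_val s : {set 'I_r}) then b j k else 1).
have MAB : M = A *m B.
  apply/matrixP=> i j; rewrite !mxE bigA_distr.
  rewrite [LHS](reindex (@enum_val _ {set 'I_r})) /=; last first.
    exact/onW_bij/enum_val_bij.
  apply: eq_bigr => s _; rewrite !mxE -big_split /=.
  by apply: eq_bigr => k _; case: ifP => _; rewrite ?mulr1 ?mul1r.
have Mdiag : M = diag_mx (\row_i M i i).
  apply/matrixP=> i j; rewrite !mxE; case: eqVneq => [->|nij]; first by rewrite mulr1n.
  have [k eqk] := (hab i j).2 nij.
  by rewrite mulr0n (bigD1 k) //= eqk subrr mul0r.
have: \rank M = m.
  apply: mxrank_unit; rewrite Mdiag unitmxE det_diag unitfE.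
  apply/prodf_neq0 => i _; rewrite !mxE; apply/prodf_neq0 => k _.
  rewrite subr_eq0; apply/eqP => eqk.
  by have /eqP := (hab i i).1 (ex_intro _ k (esym eqk)).
move=> <-; rewrite MAB; apply: leq_trans (mulmx_max_rank _ _) _.
by rewrite -cardsT -powersetT card_powerset cardsT card_ord.
Qed.

(** In a minimal set [S] of points whose tuples agree with no single [g u],
deleting [x] leaves a set served by some [f x]; the tuples [g x] and [g (f x)]
form a set-pair system, which forces [#|S| <= 2 ^ r]. *)
Lemma helly_agreement (T : finType) (r : nat) (g : T -> 'I_r -> rat) :
  (forall S : {set T}, (#|S| <= 2 ^ r)%N ->
     exists u, forall x, x \in S -> exists k, g x k = g u k) ->
  exists u, forall x, exists k, g x k = g u k.
Proof.
move=> hS; apply: contrapT => ncov.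
pose uncov (S : {set T}) := ~~ [exists u, [forall (x | x \in S), [exists k, g x k == g u k]]].
have uncovP (S : {set T}) :
    reflect (exists u, forall x, x \in S -> exists k, g x k = g u k) (~~ uncov S).
  rewrite negbK; apply: (iffP existsP) => -[u hu]; exists u.
    by move=> x xS; have /existsP[k /eqP] := forall_inP hu x xS; exists k.
  by apply/forall_inP => x /hu[k /eqP ?]; apply/existsP; exists k.
have uT : uncov [set: T].
  apply: contrapT => /negP/uncovP[u hu]; apply: ncov; exists u => x.
  by apply: hu; rewrite inE.
have [S /minsetP[uS minS] _] := minset_exists uT.
have xf x : exists u, x \in S -> (forall y, y \in S -> (exists k, g y k = g u k) <-> y != x).
  have [xS|_] := boolP (x \in S); last by exists x.
  have /uncovP[u hu] : ~~ uncov (S :\ x).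
    apply/negP => /minS/(_ (subsetDl _ _)) e.
    by move: xS; rewrite -e !inE eqxx.
  exists u => _ y yS; split; last by move=> nyx; apply: hu; rewrite !inE nyx.
  move=> [k ek]; apply/eqP => eyx; suff: ~~ uncov S by rewrite uS.
  apply/uncovP; exists u => z zS; have [->|nzx] := eqVneq z x.
    by exists k; rewrite -eyx.
  by apply: hu; rewrite !inE nzx.
have [f hf] := choice xf.
have card : (#|S| <= 2 ^ r)%N.
  apply: (@set_pair_bound r #|S| (fun i => g (enum_val i)) (fun i => g (f (enum_val i)))).
  move=> i j; rewrite hf ?enum_valP // (inj_eq enum_val_inj) //.
have /uncovP := hS S card.
by rewrite uS.
Qed.

(** * Covering by components through common neighbours *)

Lemma adj_sym (T : finType) (E : {set {set T}}) : symmetric (adj E).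
Proof. by move=> x y; rewrite /adj eq_sym setUC. Qed.

Lemma adjS (T : finType) (E E' : {set {set T}}) :
  E \subset E' -> subrel (adj E) (adj E').
Proof. by move=> /subsetP sE x y; rewrite /adj => /andP[-> /sE ->]. Qed.

(** A cycle through the new vertex [v] would enter and leave it through [u],
its only neighbour; other cycles already lie in [H]. *)
Lemma add_leaf (T : finType) (H : {set T} * {set {set T}}) (u v : T) :
  (forall e, e \in H.2 -> e \subset H.1) -> tree H -> u \in H.1 -> v \notin H.1 ->
  tree (v |: H.1, [set u; v] |: H.2).
Proof.
case: H => V E /= hE [[/= V0 conn] /= acy] uV vV.
have neuv : u != v by apply: contraNneq vV => <-.
set E' := _ |: E.
have sE : E \subset E' by apply: subsetUr.
have cuv : connect (adj E') u v by rewrite connect1 // /adj neuv !inE eqxx.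
have csym : connect_sym (adj E') by apply: sym_connect_sym; exact: adj_sym.
have old x y : x \in V -> y \in V -> connect (adj E') x y.
  by move=> xV yV; apply: connect_sub (conn x y xV yV) => a b /(adjS sE)/connect1.
split; first split=> /=.
- by apply/set0Pn; exists v; rewrite !inE eqxx.
- have all x : x \in v |: V -> connect (adj E') u x.
    by rewrite !inE => /predU1P[->|xV] //; apply: old.
  by move=> x y /all xu /all; apply: connect_trans; rewrite csym.
- move=> s sz cyc.
  have adjv w : adj E' v w -> w = u.
    rewrite /adj !inE => /andP[nvw /orP[/eqP e|/hE/subsetP/(_ v)]]; last first.
      by rewrite !inE eqxx (negbTE vV) => /(_ isT).
    have : w \in [set u; v] by rewrite -e !inE eqxx orbT.
    by rewrite !inE => /orP[/eqP //|/eqP ewv]; rewrite ewv eqxx in nvw.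
  have adjold x y : x != v -> y != v -> adj E' x y -> adj E x y.
    move=> xv yv; rewrite /adj !inE => /andP[-> /orP[/eqP e|->]] //=.
    have : v \in [set x; y] by rewrite e !inE eqxx orbT.
    by rewrite !inE eq_sym (negbTE xv) eq_sym (negbTE yv).
  have [vs|vs] := boolP (v \in s); last first.
    apply: (acy s sz); move: cyc; rewrite /ucycle => /andP[cyc ->]; rewrite andbT.
    apply: (sub_in_cycle (P := [pred x | x != v]) _ _ cyc) => [x y|].
      exact: adjold.
    by apply/allP => x xs /=; apply: contraNneq vs => <-.
  have [i t est] := rot_to vs.
  move: sz cyc; rewrite /ucycle -(size_rot i) -(rot_cycle i) -(rot_uniq i) est.
  case: t {est} => [|a [|b t]] // _ /andP[] /=.
  rewrite rcons_path => /and4P[va _ _ lv].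
  move=> /and3P[_ anb _]; move: anb; rewrite (adjv _ va).
  move: lv; rewrite adj_sym => /adjv <-; by rewrite mem_last.
Qed.

Definition colour_class (T : finType) (r : nat) (G : {set {set T}})
    (c : {set T} -> 'I_r) (k : 'I_r) : {set {set T}} :=
  [set e in G | c e == k].

(** A largest monochromatic tree through [x] cannot be extended by a leaf, so
its vertex set is closed under edges of that colour. *)
Lemma spanning_tree (T : finType) (r : nat) (G : {set {set T}})
    (c : {set T} -> 'I_r) (k : 'I_r) (x : T) :
  exists H, [/\ subgraph G H, tree H, monochromatic c H &
    forall y, connect (adj (colour_class G c k)) x y -> y \in H.1].
Proof.
set E := colour_class G c k.
pose P (H : {set T} * {set {set T}}) :=
  `[< [/\ subgraph E H, tree H & x \in H.1] >].
have P0 : P ([set x], set0).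
  apply/asboolP; split; last by rewrite inE.
    by split=> [|e]; rewrite ?sub0set ?inE.
  split; first split=> /=.
  - by apply/set0Pn; exists x; rewrite inE.
  - by move=> y z; rewrite !inE => /eqP -> /eqP ->; exact: connect0.
  - by case=> [|y [|z s]] //= _ /andP[/andP[]]; rewrite /adj inE andbF.
have [H /asboolP[[HE HV] tH xH] maxH] := arg_maxnP (fun H : {set T} * {set {set T}} => #|H.1|) P0.
exists H; split => //.
- split=> //; apply: subset_trans HE _; apply/subsetP => e.
  by rewrite inE => /andP[].
- move=> e f /(subsetP HE); rewrite inE => /andP[_ /eqP ->].
  by move/(subsetP HE); rewrite inE => /andP[_ /eqP ->].
move=> y /connectP[p]; elim/last_ind: p y => [|p z IH] y /=; first by move=> _ ->.
rewrite rcons_path last_rcons => /andP[/IH/(_ erefl) uH uz] ->.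
apply/negPn/negP => zH; set u := last x p in uH uz.
have := maxH (z |: H.1, [set u; z] |: H.2); rewrite /= cardsU1 zH ltnn => contra.
suff: false by []; apply: contra; apply/asboolP; split.
- split=> /=; first by rewrite subUset HE andbT sub1set; case/andP: uz.
  move=> e; rewrite !inE => /orP[/eqP ->|/HV].
    by rewrite subUset !sub1set !inE uH orbT eqxx.
  by move=> /subset_trans -> //; exact: subsetUr.
- exact: add_leaf.
- by rewrite !inE xH orbT.
Qed.

(** The roots of the colour-[k] components serve as coordinates; the colour of
the edge from [x] to [u] is a coordinate on which both agree. *)
Lemma common_nbr_coverable (T : finType) (r : nat) (G : {set {set T}}) :
  (forall S : {set T}, (#|S| <= 2 ^ r)%N ->
     exists u, forall x, x \in S -> x = u \/ adj G u x) ->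
  tree_coverable r G r.
Proof.
move=> hS c.
pose R k := adj (colour_class G c k).
have Rsym k : connect_sym (R k) by apply: sym_connect_sym; exact: adj_sym.
pose g x k : rat := (enum_rank (fingraph.root (R k) x))%:R.
have gE x y k : (g x k = g y k) <-> connect (R k) x y.
  rewrite -(root_connect (Rsym k)); split=> [/eqP|/eqP e]; last by rewrite /g e.
  by rewrite eqr_nat => /eqP/ord_inj/enum_rank_inj ->.
have [|u hu] := @helly_agreement T r g.
  move=> S /hS[u hu]; exists u => x /hu hx.
  have [exu|nxu] := eqVneq x u.
    by exists (c set0); rewrite exu.
  case: hx => [e|ux]; first by rewrite e eqxx in nxu.
  exists (c [set u; x]); apply/gE; rewrite Rsym; apply: connect1.
  by move: ux; rewrite /R /adj !inE eqxx andbT.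
have /choice[t ht] := fun k => spanning_tree G c k u.
exists [set t k | k in 'I_r]; split.
- by apply: leq_trans (leq_imset_card _ _) _; rewrite card_ord.
- by move=> H /imsetP[k _ ->]; case: (ht k).
- move=> v; have [k /gE vu] := hu v; exists (t k); first exact: imset_f.
  by case: (ht k) => _ _ _; apply; rewrite Rsym.
Qed.

(** * A gadget that cannot be covered *)

Lemma subset_of_card (X : finType) (B : {set X}) (k : nat) :
  (k <= #|B|)%N -> exists2 A : {set X}, A \subset B & #|A| = k.
Proof.
rewrite -bin_gt0 -cards_draws => /card_gt0P[A]; rewrite inE => /andP[sA /eqP cA].
by exists A.
Qed.

(** The two sizes add up to [s.+1]: a set carrying the bit [true] therefore meets
every set of size [s./2], while [s] chosen pairs (colour, bit) always leave room
for a label avoiding them. *)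
Definition label_ok (s : nat) (l : bool * {set 'I_s} * 'I_s.+1) : bool :=
  #|l.1.2| == if l.1.1 then (s.+1 - s./2)%N else s./2.

Definition label (s : nat) : finType := {l | @label_ok s l}.

Definition lbit (s : nat) (l : label s) : bool := (val l).1.1.
Definition lset (s : nat) (l : label s) : {set 'I_s} := (val l).1.2.

(** There are ['C(s, s./2)] sets of size [s./2], so one of them, [f], is not the
set of any label of [L].  A label of bit [false] has a set of that size
different from [f], hence not inside [f]; a label of bit [true] has a set too
large to be disjoint from [f]. *)
Lemma label_transversal (s : nat) (L : {set label s}) :
  (#|L| < 'C(s, s./2))%N ->
  exists f : {set 'I_s}, forall l, l \in L ->
    exists2 j, j \in lset l & (j \in f) = lbit l.
Proof.
move=> cL.
have [P cP PL] : exists2 P : {set 'I_s}, #|P| = s./2 & P \notin (@lset s) @: L.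
  apply: contrapT => noP; move: cL; rewrite ltnNge => /negP; apply.
  apply: leq_trans (leq_imset_card (@lset s) L).
  rewrite -[X in 'C(X, _)](card_ord s) -card_draws; apply: subset_leq_card.
  apply/subsetP => P; rewrite inE => /eqP cP; apply/negPn/negP => nP.
  by apply: noP; exists P.
exists P => l lL; have := valP l; rewrite /label_ok -/(lset l) -/(lbit l).
have half : (s./2 <= s)%N by lia.
case: (lbit l) => /eqP cl.
- have [j /andP[jl jP]|no] := pickP [pred j | (j \in lset l) && (j \in P)].
    by exists j.
  have : lset l \subset ~: P.
    by apply/subsetP => j jl; have := no j; rewrite !inE /= jl /= => ->.
  move/subset_leq_card; rewrite cl cardsCs setCK card_ord cP.
  by rewrite subSn // ltnn.
- have : ~~ (lset l \subset P).
    apply/negP => sub; move/negP: PL; apply; apply/imsetP; exists l => //.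
    by apply/esym/eqP; rewrite eqEcard sub cl cP leqnn.
  case/subsetPn => j jl jP; exists j => //; exact: negbTE.
Qed.

(** Splitting [U] by its bit, either fewer than [s - s./2 + 1] colours are used
with [false], or at most [s./2 - 1] are used with [true]; the unused colours then
contain a set of the size prescribed for that bit. *)
Lemma label_escape (s : nat) (U : {set 'I_s * bool}) :
  (#|U| <= s)%N ->
  exists (P : {set 'I_s}) (b : bool),
    (forall t, label_ok (b, P, t)) /\ (forall j, j \in P -> (j, b) \notin U).
Proof.
move=> cU.
pose U_ b := [set j | (j, b) \in U].
have esc b k : (#|U_ b| + k <= s)%N ->
    exists2 P : {set 'I_s}, #|P| = k & forall j, j \in P -> (j, b) \notin U.
  move=> h; have [|P sP cP] := @subset_of_card _ (~: U_ b) k.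
    by rewrite cardsCs setCK card_ord -(leq_add2l #|U_ b|) subnKC // (leq_trans _ h) // leq_addr.
  by exists P => // j /(subsetP sP); rewrite !inE.
have half : (s./2 <= s)%N by lia.
have sumU : (#|U_ false| + #|U_ true| <= s)%N.
  apply: leq_trans cU.
  have im b : #|[set (j, b) | j in U_ b]| = #|U_ b|.
    by apply: card_imset => i j [].
  rewrite -(im false) -(im true).
  have dis : [set (j, false) | j in U_ false] :&: [set (j, true) | j in U_ true] = set0.
    by apply/setP => x; rewrite !inE; apply/negP => /andP[/imsetP[? _ ->] /imsetP[? _ []]].
  rewrite -cardsUI dis cards0 addn0; apply: subset_leq_card.
  by rewrite subUset; apply/andP; split; apply/subsetP => x /imsetP[j];
     rewrite inE => ? ->.
have [le|gt] := leqP (#|U_ false| + s./2) s.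
  have [P cP PU] := esc _ _ le; exists P, false; split=> // t.
  by rewrite /label_ok cP.
have [|P cP PU] := esc true (s.+1 - s./2)%N.
  have : (s - s./2 < #|U_ false|)%N by rewrite ltn_subLR // addnC.
  by move: sumU half; lia.
exists P, true; split=> // t.
by rewrite /label_ok cP.
Qed.

(** The requirements on different edges do not interfere: an edge meeting the
image of [phi] in one vertex determines both [u] and [l]. *)
Lemma gadget_colouring (V : finType) (s : nat) (G : {set {set V}})
    (phi : label s -> V) (f : V -> {set 'I_s}) :
  injective phi ->
  (forall u l, u \notin codom phi -> [set u; phi l] \in G ->
     exists2 j, j \in lset l & (j \in f u) = lbit l) ->
  exists c : {set V} -> 'I_s.+1,
    (forall u l, u \notin codom phi -> [set u; phi l] \in G ->
       exists j, [/\ c [set u; phi l] = widen_ord (leqnSn s) j,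
                     j \in lset l & (j \in f u) = lbit l]) /\
    (forall u v, u \notin codom phi -> v \notin codom phi ->
       c [set u; v] = ord_max).
Proof.
move=> phi_inj hf.
pose col (e : {set V}) (x : 'I_s.+1) :=
  (forall u l, u \notin codom phi -> e = [set u; phi l] -> e \in G ->
       exists j, [/\ x = widen_ord (leqnSn s) j,
                     j \in lset l & (j \in f u) = lbit l]) /\
    (forall u v, u \notin codom phi -> v \notin codom phi ->
       e = [set u; v] -> x = ord_max).
have /choice[c hc] : forall e, exists x, col e x.
  move=> e.
  have [[u [l [uphi ee eG]]]|no] :=
    pselect (exists u l, [/\ u \notin codom phi, e = [set u; phi l] & e \in G]).
    have := eG; rewrite {1}ee => /(hf u l uphi)[j jl jf].
    exists (widen_ord (leqnSn s) j); split=> [u' l' u'phi ee' _|u' v' u'phi v'phi ee'].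
      have eqs : [set u; phi l] = [set u'; phi l'] by rewrite -ee -ee'.
      have eu : u = u'.
        have : u \in [set u'; phi l'] by rewrite -eqs !inE eqxx.
        by rewrite !inE => /orP[/eqP //|/eqP e1]; rewrite e1 codom_f in uphi.
      have el : l = l'.
        have : phi l \in [set u'; phi l'] by rewrite -eqs !inE eqxx orbT.
        rewrite !inE => /orP[/eqP e1|/eqP /phi_inj //].
        by rewrite -e1 codom_f in u'phi.
      by exists j; split; rewrite -?eu -?el.
    have : phi l \in [set u'; v'] by rewrite -ee' ee !inE eqxx orbT.
    rewrite !inE => /orP[/eqP e1|/eqP e1].
      by rewrite -e1 codom_f in u'phi.
    by rewrite -e1 codom_f in v'phi.
  exists ord_max; split=> // u l uphi ee eG.
  by case: no; exists u, l.
exists c; split=> [u l uphi eG|u v uphi vphi].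
  by have [h _] := hc [set u; phi l]; apply: h.
by have [_ h] := hc [set u; v]; apply: (h u v).
Qed.

Lemma connect_step (T : finType) (e : rel T) (x y : T) :
  x != y -> connect e x y -> exists z, e x z.
Proof.
move=> nxy /connectP[[|z p] /=]; first by move=> _ eyx; rewrite eyx eqxx in nxy.
by case/andP=> xz _ _; exists z.
Qed.

(** [Z] has more vertices than there are trees, so some tree contains two of
them and hence an edge at [Z]; it has the last colour and misses the gadget.  The remaining
[s] trees block at most [s] pairs (colour, bit); a pair (bit, set) escaping
those pairs has [s.+1] copies, and these need a separate tree each. *)
Lemma sparse_gadget_not_coverable (V : finType) (s : nat) (G : {set {set V}})
    (phi : label s -> V) (Z : {set V}) :
  injective phi ->
  (forall l l', [set phi l; phi l'] \notin G) ->
  (forall u, u \notin codom phi -> (#|[set l | [set u; phi l] \in G]| < 'C(s, s./2))%N) ->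
  (s.+1 < #|Z|)%N ->
  (forall z, z \in Z -> z \notin codom phi) ->
  (forall z l, z \in Z -> [set z; phi l] \notin G) ->
  ~ tree_coverable s.+1 G s.+1.
Proof.
move=> phi_inj indep deg cZ Zphi Znbr.
have hf u : exists f : {set 'I_s}, u \notin codom phi -> forall l, [set u; phi l] \in G ->
     exists2 j, j \in lset l & (j \in f) = lbit l.
  have [_|uphi] := boolP (u \in codom phi); first by exists set0.
  have [f hf] := label_transversal (deg u uphi); exists f => _ l lG.
  by apply: hf; rewrite inE.
have {hf}/choice[f hf] := hf.
have [|c [cin cout]] := @gadget_colouring V s G phi f phi_inj.
  by move=> u l uphi; apply: hf.
move=> /(_ c)[F [cF trF covF]].
(* Some tree meets Z twice, hence uses the last colour and misses the gadget. *)
have /choice[t ht] : forall v : V, exists H, H \in F /\ v \in H.1.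
  by move=> v; have [H ? ?] := covF v; exists H.
have [z [z' [zZ z'Z nzz' tzz']]] : exists z z', [/\ z \in Z, z' \in Z, z != z' & t z = t z'].
  apply: contrapT => no.
  have : (#|t @: Z| <= #|F|)%N.
    by apply: subset_leq_card; apply/subsetP => _ /imsetP[v _ ->]; case: (ht v).
  rewrite card_in_imset; first by move/(leq_trans cZ)/leq_trans => /(_ _ cF); rewrite ltnn.
  move=> x y xZ yZ exy; apply/eqP/negPn/negP => nxy; apply: no.
  by exists x, y.
set H0 := t z in tzz'.
have [H0F zH0] := ht z; have [_ z'H0] := ht z'; rewrite -/H0 -?tzz' in H0F zH0 z'H0.
have tree_edge H x y : H \in F -> x \in H.1 -> y \in H.1 -> x != y ->
    exists w, [/\ [set x; w] \in H.2, [set x; w] \in G & x != w].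
  move=> HF xH yH nxy; have [[/subsetP sub _] [[_ conn] _] _] := trF H HF.
  have [w /andP[nxw wH]] := connect_step nxy (conn x y xH yH).
  by exists w; split=> //; apply: sub.
have H0phi l : phi l \notin H0.1.
  apply/negP => lH0.
  have [w [zw1 zw2 _]] := tree_edge H0 z z' H0F zH0 z'H0 nzz'.
  have wphi : w \notin codom phi.
    by apply/codomP => -[l' ew]; move: zw2; apply/negP; rewrite ew Znbr.
  have nlz : phi l != z by apply: contraNneq (Zphi z zZ) => <-; apply: codom_f.
  have [w' [lw1 lw2 _]] := tree_edge H0 (phi l) z H0F lH0 zH0 nlz.
  have w'phi : w' \notin codom phi.
    by apply/codomP => -[l' ew]; move: lw2; apply/negP; rewrite ew indep.
  have [_ _ mono] := trF H0 H0F.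
  have := mono _ _ zw1 lw1; rewrite (cout z w (Zphi z zZ) wphi) setUC.
  rewrite setUC in lw2; have [j [-> _ _]] := cin w' l w'phi lw2.
  by move/(congr1 val) => /= e; have := ltn_ord j; rewrite -e ltnn.
pose F' := F :\ H0.
have cF' : (#|F'| <= s)%N by move: cF; rewrite (cardsD1 H0) H0F.
have tF' l : t (phi l) \in F'.
  have [tF lt] := ht (phi l); rewrite !inE tF andbT.
  by apply: contraNneq (H0phi l) => <-.
(* A tree meeting the gadget at least twice has a colour j < s, and the bit of
   colour j is constant along its edges. *)
have typ H : exists o : option ('I_s * bool), H \in F ->
    if o is Some (j, b) then
      forall l, phi l \in H.1 -> j \in lset l /\ lbit l = b
    else forall l l', phi l \in H.1 -> phi l' \in H.1 -> l = l'.
  have [HF|_] := boolP (H \in F); last by exists None.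
  have [[l [l' [lH l'H nll']]]|no] :=
      pselect (exists l l', [/\ phi l \in H.1, phi l' \in H.1 & l <> l']); last first.
    exists None => _ l l' lH l'H; apply: contrapT => nll'.
    by apply: no; exists l, l'.
  have nbr l0 : phi l0 \in H.1 -> exists w j, [/\ [set w; phi l0] \in H.2,
      c [set w; phi l0] = widen_ord (leqnSn s) j & j \in lset l0].
    move=> l0H.
    have [x [xH nx]] : exists x, x \in H.1 /\ phi l0 != x.
      have [e0|ne0] := eqVneq l0 l.
        exists (phi l'); split=> //; rewrite e0; apply/eqP => /phi_inj; exact: nll'.
      by exists (phi l); split=> //; rewrite (inj_eq phi_inj).
    have [w [w1 w2 _]] := tree_edge H _ x HF l0H xH nx.
    rewrite setUC in w1 w2.
    have wphi : w \notin codom phi.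
      by apply/codomP => -[l1 ew]; move: w2; apply/negP; rewrite ew indep.
    have [j [cj jl _]] := cin w l0 wphi w2.
    by exists w, j.
  have [[/subsetP subG _] [[_ conn] _] mono] := trF H HF.
  have [w0 [j [w0H cw0 _]]] := nbr l lH.
  have colH e : e \in H.2 -> c e = widen_ord (leqnSn s) j.
    by move=> eH; rewrite -cw0; apply: mono.
  have widen_inj : injective (widen_ord (leqnSn s)).
    by move=> i1 i2 /(congr1 val) /= /val_inj.
  pose lab x := if [pick l0 | phi l0 == x] is Some l0 then lbit l0 else j \in f x.
  have labphi l0 : lab (phi l0) = lbit l0.
    rewrite /lab; case: pickP => [l1 /eqP /phi_inj -> //|/(_ l0)].
    by rewrite eqxx.
  have labout x : x \notin codom phi -> lab x = (j \in f x).
    rewrite /lab; case: pickP => // l1 /eqP <-; by rewrite codom_f.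
  have labin u l0 : u \notin codom phi -> [set u; phi l0] \in H.2 -> lab u = lab (phi l0).
    move=> uphi uH; have [j' []] := cin u l0 uphi (subG _ uH).
    by rewrite colH // => /widen_inj <- _; rewrite labout // labphi.
  have labadj x y : adj H.2 x y -> lab x = lab y.
    case/andP=> _ xyH.
    have [/codomP[lx ex]|xphi] := boolP (x \in codom phi);
    have [/codomP[ly ey]|yphi] := boolP (y \in codom phi).
    - by move: (subG _ xyH); rewrite ex ey (negbTE (indep _ _)).
    - by rewrite ex; apply/esym/labin; rewrite // setUC -ex.
    - by rewrite ey; apply: labin; rewrite // -ey.
    - have := colH _ xyH; rewrite cout // => /(congr1 val) /= e.
      by have := ltn_ord j; rewrite -e ltnn.
  have labconn x y : x \in H.1 -> y \in H.1 -> lab x = lab y.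
    move=> xH yH; have /connectP[p] := conn x y xH yH.
    elim: p x {xH} => [x _ -> //|w p IH x /= /andP[/labadj -> pth] el].
    exact: IH.
  exists (Some (j, lbit l)) => _ l0 l0H; split.
    have [w [j' [wH cw j'l]]] := nbr l0 l0H.
    by move: cw; rewrite colH // => /widen_inj ->.
  by rewrite -!labphi; apply: labconn.
have {typ}/choice[ty hty] := typ.
pose U := [set jb | Some jb \in ty @: F'].
have cU : (#|U| <= s)%N.
  apply: leq_trans cF'; apply: leq_trans (leq_imset_card ty F').
  rewrite -(card_imset _ (@Some_inj _)); apply: subset_leq_card.
  by apply/subsetP => _ /imsetP[jb jbU ->]; rewrite inE in jbU.
have [P [b [okP PU]]] := label_escape cU.
pose lt i : label s := exist _ (b, P, i) (okP i).
have tynone i : ty (t (phi (lt i))) = None.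
  have [tF lt_] := ht (phi (lt i)).
  case e: (ty _) => [[j b']|] //; have := hty _ tF; rewrite e => /(_ _ lt_)[jP /= eb].
  case/negP: (PU j jP); rewrite inE; apply/imsetP; exists (t (phi (lt i))) => //.
  by rewrite e -eb.
have inj : injective (fun i => t (phi (lt i))).
  move=> i i' /= e; have [tF li] := ht (phi (lt i)).
  have [_ li'] := ht (phi (lt i')).
  have := hty _ tF; rewrite tynone => /(_ (lt i) (lt i') li).
  by rewrite e => /(_ li')[].
have := subset_leq_card (_ : [set t (phi (lt i)) | i in 'I_s.+1] \subset F').
rewrite card_imset // card_ord => h.
have /h/leq_trans/(_ cF') : [set t (phi (lt i)) | i in 'I_s.+1] \subset F'.
  by apply/subsetP => _ /imsetP[i _ ->].
by rewrite ltnn.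
Qed.

(** * The product measure on edge sets *)

(** The expectation of [f G] when [G] contains each element of [D] independently
with probability [p]. *)
Definition expect (R : realFieldType) (X : finType) (D : {set X}) (p : R)
    (f : {set X} -> R) : R :=
  \sum_(G in powerset D) f G * \prod_(e in D) (if e \in G then p else 1 - p).

Definition prob (R : realFieldType) (X : finType) (D : {set X}) (p : R)
    (A : pred {set X}) : R :=
  expect D p (fun G => (A G)%:R).

Lemma expect_set0 (R : realFieldType) (X : finType) (p : R) (f : {set X} -> R) :
  expect set0 p f = f set0.
Proof.
by rewrite /expect powerset0 big_set1 big_pred0 ?mulr1 // => e; rewrite inE.
Qed.

(** Conditioning on whether [e] is present; independence is proved by induction
on [D] along this recursion. *)
Lemma expect_setU1 (R : realFieldType) (X : finType) (D : {set X}) (p : R)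
    (e : X) (f : {set X} -> R) :
  e \notin D ->
  expect (e |: D) p f = p * expect D p (fun G => f (e |: G)) + (1 - p) * expect D p f.
Proof.
move=> eD; rewrite /expect (bigID (fun G : {set X} => e \in G)) /= !mulr_sumr.
have eq_ne x : x \in D -> x != e by apply: contraTneq => ->.
congr (_ + _).
- rewrite (reindex_onto (fun G => e |: G) (fun G => G :\ e)) /=; last first.
    by move=> G /andP[_ eG]; rewrite setD1K.
  apply: eq_big => [G|G _]; rewrite ?powersetE.
    rewrite !inE eqxx /= andbT; apply/andP/idP => [[sub /eqP e1]|sub]; last first.
      rewrite setUS //; split=> //; apply/eqP/setU1K.
      by apply: contra eD; apply: subsetP sub e.
    apply/subsetP => x xG; have : x \in e |: D by apply: (subsetP sub); rewrite inE xG orbT.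
    rewrite !inE => /orP[/eqP xe|//].
    by move: xG; rewrite -e1 xe !inE eqxx.
  rewrite big_setU1 //= !inE eqxx /= mulrCA; congr (_ * (_ * _)).
  by apply: eq_bigr => x /eq_ne/negbTE nx; rewrite !inE nx.
- apply: eq_big => [G|G /andP[_ eG]]; rewrite ?powersetE.
    apply/andP/idP => [[sub eG]|sub].
      apply/subsetP => x xG; have := subsetP sub x xG.
      by rewrite !inE => /orP[/eqP xe|//]; rewrite -xe xG in eG.
    split; first by apply: subset_trans sub _; exact: subsetUr.
    by apply: contra eD; apply: subsetP sub e.
  by rewrite big_setU1 //= (negbTE eG) mulrCA.
Qed.

Lemma set_ind1 (X : finType) (P : {set X} -> Prop) :
  P set0 -> (forall e (D : {set X}), e \notin D -> P D -> P (e |: D)) -> forall D, P D.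
Proof.
move=> P0 PS D; move: {2}#|D| (erefl #|D|) => n; elim: n D => [D /eqP|n IH D cD].
  by rewrite cards_eq0 => /eqP ->.
have /card_gt0P[e eD] : (0 < #|D|)%N by rewrite cD.
rewrite -(setD1K eD); apply: PS; first by rewrite !inE eqxx.
by apply: IH; move: cD; rewrite (cardsD1 e) eD => -[].
Qed.

Lemma expect1 (R : realFieldType) (X : finType) (D : {set X}) (p : R) :
  expect D p (fun=> 1) = 1.
Proof.
elim/set_ind1: D => [|e D eD IH]; first by rewrite expect_set0.
by rewrite expect_setU1 // IH !mulr1 addrC subrK.
Qed.

Lemma expectZ (R : realFieldType) (X : finType) (D : {set X}) (p a : R) (f : {set X} -> R) :
  expect D p (fun G => a * f G) = a * expect D p f.
Proof. by rewrite /expect mulr_sumr; apply: eq_bigr => G _; rewrite mulrA. Qed.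

Lemma expectD (R : realFieldType) (X : finType) (D : {set X}) (p : R) (f g : {set X} -> R) :
  expect D p (fun G => f G + g G) = expect D p f + expect D p g.
Proof. by rewrite /expect -big_split; apply: eq_bigr => G _; rewrite mulrDl. Qed.

Lemma eq_expect (R : realFieldType) (X : finType) (D : {set X}) (p : R) (f g : {set X} -> R) :
  (forall G : {set X}, G \subset D -> f G = g G) -> expect D p f = expect D p g.
Proof. by move=> fg; apply: eq_bigr => G; rewrite powersetE => /fg ->. Qed.

Lemma le_expect (R : realFieldType) (X : finType) (D : {set X}) (p : R) (f g : {set X} -> R) :
  0 <= p <= 1 -> (forall G : {set X}, G \subset D -> f G <= g G) -> expect D p f <= expect D p g.
Proof.
move=> /andP[p0 p1] fg; apply: ler_sum => G; rewrite powersetE => /fg fgG.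
apply: ler_wpM2r => //; apply: prodr_ge0 => e _; case: ifP => _ //.
by rewrite subr_ge0.
Qed.

Definition depends_on (X : finType) (Y : Type) (E : {set X}) (f : {set X} -> Y) : Prop :=
  forall G G', G :&: E = G' :&: E -> f G = f G'.

Lemma depends_onS (X : finType) (Y : Type) (E E' : {set X}) (f : {set X} -> Y) :
  E \subset E' -> depends_on E f -> depends_on E' f.
Proof. by move=> sE hf G G' GG'; apply: hf; rewrite -(setIidPr sE) !setIA GG'. Qed.

Lemma setU1I_out (X : finType) (e : X) (E G : {set X}) :
  e \notin E -> (e |: G) :&: E = G :&: E.
Proof.
move=> eE; apply/setP => x; rewrite !inE; case: eqVneq => [->|//].
by rewrite (negbTE eE) !andbF.
Qed.

(** Revealing the elements of [D] one at a time, each affects at most one of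
the two factors. *)
Lemma expect_indep (R : realFieldType) (X : finType) (D E1 E2 : {set X}) (p : R)
    (f g : {set X} -> R) :
  [disjoint E1 & E2] -> depends_on E1 f -> depends_on E2 g ->
  expect D p (fun G => f G * g G) = expect D p f * expect D p g.
Proof.
move=> dis; elim/set_ind1: D f g => [|e D eD IH] f g hf hg; first by rewrite !expect_set0.
have shift E h : depends_on E h -> depends_on E (fun G => h (e |: G) : R).
  by move=> hh G G' GG'; apply: hh; rewrite !setIUl GG'.
have out (E : {set X}) (h : {set X} -> R) : e \notin E ->
    depends_on E h -> forall G, h (e |: G) = h G :> R.
  by move=> eE hh G; apply: hh; exact: setU1I_out.
rewrite !expect_setU1 // (IH _ _ hf hg) (IH _ _ (shift _ _ hf) (shift _ _ hg)).
have [eE1|eE1] := boolP (e \in E1).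
- have eE2 : e \notin E2 by rewrite (disjointFr dis eE1).
  rewrite (@eq_expect _ _ D p (fun G => g (e |: G)) g); last by move=> G _; exact: out hg G.
  by ring.
- rewrite (@eq_expect _ _ D p (fun G => f (e |: G)) f); last by move=> G _; exact: out hf G.
  by ring.
Qed.

Lemma prob_indep (R : realFieldType) (X : finType) (D E1 E2 : {set X}) (p : R)
    (A B : pred {set X}) :
  [disjoint E1 & E2] -> depends_on E1 A -> depends_on E2 B ->
  prob D p (fun G => A G && B G) = prob D p A * prob D p B.
Proof.
move=> dis hA hB; rewrite /prob -(expect_indep _ _ dis).
- by apply: eq_expect => G _; rewrite -natrM mulnb.
- by move=> G G' /hA ->.
- by move=> G G' /hB ->.
Qed.

Lemma prob_le (R : realFieldType) (X : finType) (D : {set X}) (p : R) (A B : pred {set X}) :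
  0 <= p <= 1 -> (forall G : {set X}, G \subset D -> A G -> B G) -> prob D p A <= prob D p B.
Proof.
move=> p01 AB; apply: le_expect => // G /AB; case: (A G) => [->|_] //.
Qed.

Lemma probT (R : realFieldType) (X : finType) (D : {set X}) (p : R) :
  prob D p xpredT = 1.
Proof. exact: expect1. Qed.

Lemma prob_ge0 (R : realFieldType) (X : finType) (D : {set X}) (p : R) (A : pred {set X}) :
  0 <= p <= 1 -> 0 <= prob D p A.
Proof.
move=> p01; have -> : 0 = expect D p (fun=> 0).
  by rewrite /expect big1 // => G _; rewrite mul0r.
by apply: le_expect => // G _; rewrite ler0n.
Qed.

Lemma probC (R : realFieldType) (X : finType) (D : {set X}) (p : R) (A : pred {set X}) :
  prob D p (fun G => ~~ A G) = 1 - prob D p A.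
Proof.
apply/eqP; rewrite eq_sym subr_eq -(probT D p) /prob -expectD; apply/eqP.
by apply: eq_expect => G _; case: (A G); rewrite ?add0r ?addr0.
Qed.

Lemma prob_union (R : realFieldType) (X I : finType) (J : {pred I}) (D : {set X}) (p : R)
    (A : I -> pred {set X}) :
  0 <= p <= 1 ->
  prob D p (fun G => [exists i in J, A i G]) <= \sum_(i in J) prob D p (A i).
Proof.
move=> p01; rewrite /prob /expect exchange_big /=; apply: ler_sum => G _.
rewrite -mulr_suml; apply: ler_wpM2r.
  apply: prodr_ge0 => e _; case/andP: p01 => p0 p1; case: ifP => _ //.
  by rewrite subr_ge0.
case: exists_inP => [[i iJ AiG]|_].
  by rewrite (bigD1 i) //= AiG lerDl sumr_ge0.
by rewrite sumr_ge0.
Qed.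

Lemma prob_forall_indep (R : realFieldType) (X I : finType) (J : {pred I}) (D : {set X}) (p : R)
    (E : I -> {set X}) (A : I -> pred {set X}) :
  {in J &, forall i j, i != j -> [disjoint E i & E j]} ->
  {in J, forall i, depends_on (E i) (A i)} ->
  prob D p (fun G => [forall i in J, A i G]) = \prod_(i in J) prob D p (A i).
Proof.
move=> dis dep.
have -> : prob D p (fun G => [forall i in J, A i G]) =
          prob D p (fun G => all (fun i => A i G) (enum J)).
  apply: eq_expect => G _; congr (nat_of_bool _)%:R.
  apply/forall_inP/allP => h i; first by rewrite mem_enum; apply: h.
  by move=> iJ; apply: h; rewrite mem_enum.
rewrite -big_enum /=.
have sJ : {subset enum J <= J} by move=> i; rewrite mem_enum.
elim: (enum J) (enum_uniq J) sJ => [|i s IH] /=; first by rewrite big_nil probT.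
move=> /andP[ns us] sJ; rewrite big_cons -IH //; last first.
  by move=> j js; apply: sJ; rewrite inE js orbT.
have iJ : i \in J by apply: sJ; rewrite inE eqxx.
have jJ j : j \in s -> j \in J by move=> js; apply: sJ; rewrite inE js orbT.
apply: (@prob_indep _ _ _ (E i) (\bigcup_(j in s) E j)).
- apply/bigcup_disjointP => j js; apply: dis => //; first exact: jJ.
  by apply: contraNneq ns => ->.
- exact: dep.
move=> G G' GG'; apply: eq_in_all => j js.
by apply: depends_onS GG'; [exact: (bigcup_sup j) | exact: dep j (jJ j js)].
Qed.

Lemma prob_mem (R : realFieldType) (X : finType) (D : {set X}) (p : R) (e : X) :
  e \in D -> prob D p (fun G => e \in G) = p.
Proof.
move=> eD; rewrite /prob -(setD1K eD) expect_setU1 ?inE ?eqxx //.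
rewrite (@eq_expect _ _ _ _ _ (fun=> 1)); last by move=> G _; rewrite !inE eqxx.
rewrite expect1 mulr1 (@eq_expect _ _ _ _ _ (fun G => 0 * 1)); last first.
  move=> G /subsetP sub; rewrite mul0r; case: (boolP (e \in G)) => // /sub.
  by rewrite !inE eqxx.
by rewrite expectZ mul0r mulr0 addr0.
Qed.

Lemma prob_subset (R : realFieldType) (X : finType) (D E : {set X}) (p : R) :
  E \subset D -> prob D p (fun G => E \subset G) = p ^+ #|E|.
Proof.
move=> ED; rewrite -prodr_const.
have -> : prob D p (fun G => E \subset G) = prob D p (fun G => [forall e in E, e \in G]).
  apply: eq_expect => G _; congr (nat_of_bool _)%:R.
  by apply/subsetP/forall_inP.
rewrite (@prob_forall_indep _ _ _ _ _ _ (fun e => [set e])).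
- by apply: eq_bigr => e eE; rewrite prob_mem // (subsetP ED).
- by move=> e f _ _ nef; rewrite disjoints1 inE.
- move=> e _ G G' /setP/(_ e); by rewrite !inE eqxx !andbT.
Qed.

(** * Probability bounds in the random graph *)

Lemma depends_on_forall (X I : finType) (J : {pred I}) (E : {set X}) (A : I -> pred {set X}) :
  {in J, forall i, depends_on E (A i)} ->
  depends_on E (fun G => [forall i in J, A i G]).
Proof.
move=> hA G G' GG'; apply: eq_forallb_in => i iJ; exact: hA iJ G G' GG'.
Qed.

Definition star (V : finType) (u : V) (S : {set V}) : {set {set V}} :=
  [set [set u; x] | x in S].

Lemma set2_inj (V : finType) (u v x y : V) :
  u != y -> [set u; x] = [set v; y] -> u = v /\ x = y.
Proof.
move=> uy e; have uv : u = v.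
  by have := set21 u x; rewrite e !inE (negbTE uy) orbF => /eqP.
split=> //; have := set22 v y; rewrite -e !inE => /orP[/eqP yu|/eqP //].
by rewrite yu eqxx in uy.
Qed.

Lemma star_disjoint (V : finType) (u v : V) (S S' : {set V}) :
  u \notin S' -> u != v \/ [disjoint S & S'] -> [disjoint star u S & star v S'].
Proof.
move=> uS' h; rewrite -setI_eq0; apply/set0Pn => -[e].
rewrite inE => /andP[/imsetP[x xS ->] /imsetP[y yS' e']].
have [|uv xy] := set2_inj _ e'; first by apply: contraNneq uS' => ->.
case: h => [|dis]; first by rewrite uv eqxx.
by move: yS'; rewrite -xy (disjointFr dis xS).
Qed.

Lemma card_star (V : finType) (u : V) (S : {set V}) :
  u \notin S -> #|star u S| = #|S|.
Proof.
move=> uS; apply: card_in_imset => x y xS yS e.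
by have [|_ ->] := set2_inj _ e; first by apply: contraNneq uS => ->.
Qed.

Lemma star_pairs (V : finType) (u : V) (S : {set V}) :
  u \notin S -> star u S \subset pairs V.
Proof.
move=> uS; apply/subsetP => _ /imsetP[x xS ->].
rewrite inE cards2; have -> // : u != x by apply: contraNneq uS => ->.
Qed.

Lemma prob_star (R : realFieldType) (V : finType) (p : R) (u : V) (S : {set V}) :
  u \notin S -> prob (pairs V) p (fun G => star u S \subset G) = p ^+ #|S|.
Proof. by move=> uS; rewrite prob_subset ?star_pairs // card_star. Qed.

Lemma depends_on_star (V : finType) (u : V) (S : {set V}) :
  depends_on (star u S) (fun G => star u S \subset G).
Proof.
by move=> G G' GG'; rewrite -[LHS](subsetIidr) GG' subsetIidr.
Qed.

Lemma depends_onN (X : finType) (E : {set X}) (A : pred {set X}) :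
  depends_on E A -> depends_on E (fun G => ~~ A G).
Proof. by move=> hA G G' /hA ->. Qed.

Lemma bin_le_exp (n k : nat) : ('C(n, k) <= n ^ k)%N.
Proof.
elim: k n => [|k IH] n; first by rewrite bin0.
apply: (@leq_trans (k.+1 * 'C(n, k.+1))%N); first by rewrite leq_pmull.
rewrite -mul_bin_diag expnS leq_mul2l; apply/orP; right.
by apply: leq_trans (IH _) _; case: (k) => [|i] //; rewrite leq_exp2r // leq_pred.
Qed.

(** The stars from distinct vertices [u] to [S] are disjoint edge sets, so the
events that they are present are independent. *)
Lemma prob_no_common_nbr (R : realFieldType) (V : finType) (p : R) (S : {set V}) :
  prob (pairs V) p (fun G => [forall u in ~: S, ~~ (star u S \subset G)]) =
  (1 - p ^+ #|S|) ^+ (#|V| - #|S|).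
Proof.
rewrite (@prob_forall_indep _ _ _ _ _ _ (fun u => star u S)).
- rewrite (eq_bigr (fun=> 1 - p ^+ #|S|)).
    by rewrite prodr_const -(cardsC S) addKn.
  by move=> u; rewrite inE => uS; rewrite probC prob_star.
- move=> u v; rewrite !inE => uS _ uv; apply: star_disjoint => //; by left.
- by move=> u _; apply/depends_onN/depends_on_star.
Qed.

Lemma tc_leP (T : finType) (r : nat) (G : {set {set T}}) m :
  tree_coverable r G m -> (tc r G <= m)%N.
Proof. by rewrite /tc; case: ex_minnP => k _ h /asboolP/h. Qed.

Lemma tc_gtP (T : finType) (r : nat) (G : {set {set T}}) m :
  ~ tree_coverable r G m -> (m < tc r G)%N.
Proof.
rewrite /tc; case: ex_minnP => k /asboolP hk _ nm; rewrite ltnNge; apply/negP => km.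
apply: nm => c; have [F [cF hF covF]] := hk c; exists F; split=> //.
exact: leq_trans km.
Qed.

(** A union bound over the vertex sets of size [2 ^ r]. *)
Lemma prob_tc_le (R : realFieldType) (V : finType) (r : nat) (p : R) :
  0 <= p <= 1 -> (2 ^ r <= #|V|)%N ->
  1 - #|V|%:R ^+ (2 ^ r) * (1 - p ^+ (2 ^ r)) ^+ (#|V| - 2 ^ r) <=
  prob (pairs V) p (fun G => (tc r G <= r)%N).
Proof.
move=> p01 hV; set K := (2 ^ r)%N in hV *.
rewrite lerBlDl -lerBlDr -probC.
pose draws := [pred S : {set V} | #|S| == K].
apply: (@le_trans _ _ (prob (pairs V) p (fun G =>
    [exists S in draws, [forall u in ~: S, ~~ (star u S \subset G)]]))).
  apply: prob_le => // G _; apply: contraR => no.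
  apply/tc_leP/common_nbr_coverable => S cS.
  have [S' sub cS'] : exists2 S' : {set V}, S \subset S' & #|S'| = K.
    have [|A sA cA] := @subset_of_card _ (~: S) (K - #|S|)%N.
      by rewrite -[#|~: S|](addKn #|S|) cardsC leq_sub2r.
    exists (S :|: A); first exact: subsetUl.
    rewrite cardsU cA (_ : S :&: A = set0) ?cards0 ?subn0 ?subnKC //.
    by apply/eqP; rewrite setI_eq0 disjoint_sym disjoints_subset.
  have : ~~ [forall u in ~: S', ~~ (star u S' \subset G)].
    apply: contra no => h; apply/exists_inP; exists S' => //=; exact/eqP.
  rewrite negb_forall_in => /exists_inP[u]; rewrite inE negbK => uS' sG.
  exists u => x xS; right; have xS' := subsetP sub x xS.
  rewrite /adj (subsetP sG) ?andbT; first by apply: contraNneq uS' => ->.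
  exact: imset_f.
apply: le_trans (prob_union _ _ _ p01) _.
rewrite (eq_bigr (fun=> (1 - p ^+ K) ^+ (#|V| - K))); last first.
  by move=> S /eqP cS; rewrite prob_no_common_nbr cS.
rewrite sumr_const -[leLHS]mulr_natl; apply: ler_wpM2r.
  by case/andP: p01 => p0 p1; rewrite exprn_ge0 // subr_ge0 exprn_ile1.
by rewrite -natrX ler_nat -[X in (X <= _)%N]cardsE card_draws bin_le_exp.
Qed.

Lemma prob_high_degree (R : realFieldType) (V L : finType) (p : R) (phi : L -> V)
    (u : V) (k : nat) :
  0 <= p <= 1 -> injective phi -> u \notin codom phi ->
  prob (pairs V) p (fun G => (k <= #|[set l | [set u; phi l] \in G]|)%N) <=
  (2 ^ #|L|)%:R * p ^+ k.
Proof.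
move=> p01 phi_inj uphi.
have uS (S : {set L}) : u \notin phi @: S.
  by apply: contra uphi => /imsetP[l _ ->]; exact: codom_f.
pose draws := [pred S : {set L} | #|S| == k].
apply: (@le_trans _ _ (prob (pairs V) p (fun G =>
    [exists S in draws, star u (phi @: S) \subset G]))).
  apply: prob_le => // G _ /subset_of_card[S sS cS].
  apply/exists_inP; exists S; first by rewrite inE cS.
  apply/subsetP => _ /imsetP[_ /imsetP[l lS ->] ->].
  by have := subsetP sS l lS; rewrite inE.
apply: le_trans (prob_union _ _ _ p01) _.
rewrite (eq_bigr (fun=> p ^+ k)); last first.
  by move=> S /eqP cS; rewrite prob_star // card_imset // cS.
rewrite sumr_const -[leLHS]mulr_natl; apply: ler_wpM2r.
  by case/andP: p01 => p0 _; exact: exprn_ge0.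
rewrite ler_nat; apply: leq_trans (max_card _) _.
by rewrite -[X in (X <= _)%N]cardsT -powersetT card_powerset cardsT.
Qed.

Lemma depends_on_degree (V L : finType) (phi : L -> V) (u : V) (k : nat) :
  depends_on (star u [set phi l | l in L])
    (fun G => (#|[set l | [set u; phi l] \in G]| < k)%N).
Proof.
move=> G G' GG'; suff -> : [set l | [set u; phi l] \in G] = [set l | [set u; phi l] \in G'] by [].
apply/setP => l; rewrite !inE.
have inS : [set u; phi l] \in star u [set phi l | l in L] by do 2 apply: imset_f.
by have := congr1 (fun E : {set {set V}} => [set u; phi l] \in E) GG';
   rewrite /= !in_setI inS !andbT.
Qed.

Lemma prob_low_degree (R : realFieldType) (V L : finType) (p : R) (phi : L -> V)
    (W : {set V}) (k : nat) :
  0 <= p <= 1 -> injective phi -> codom phi \subset W ->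
  (2 ^ #|L|)%:R * p ^+ k <= 1 ->
  (1 - (2 ^ #|L|)%:R * p ^+ k) ^+ #|V| <=
  prob (pairs V) p (fun G =>
    [forall u in ~: W, (#|[set l | [set u; phi l] \in G]| < k)%N]).
Proof.
move=> p01 phi_inj sW x1; set x := _ * _ in x1 *.
have x0 : 0 <= x.
  by apply: mulr_ge0 => //; case/andP: p01 => p0 _; exact: exprn_ge0.
rewrite (@prob_forall_indep _ _ _ _ _ _ (fun u => star u [set phi l | l in L])).
- apply: (@le_trans _ _ (\prod_(u in ~: W) (1 - x))).
    rewrite prodr_const ler_wiXn2l ?max_card //; first by rewrite subr_ge0.
    by rewrite gerBl.
  apply: ler_prod => u; rewrite inE => uW; rewrite subr_ge0 x1 /=.
  have -> : prob (pairs V) p (fun G => (#|[set l | [set u; phi l] \in G]| < k)%N) =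
    1 - prob (pairs V) p (fun G => (k <= #|[set l | [set u; phi l] \in G]|)%N).
    by rewrite -probC; apply: eq_expect => G _; rewrite ltnNge.
  rewrite lerB //; apply: prob_high_degree => //.
  by apply: contra uW; apply: (subsetP sW).
- move=> u v; rewrite !inE => uW _ uv; apply: star_disjoint; last by left.
  apply: contra uW => /imsetP[l _ ->]; apply: (subsetP sW); exact: codom_f.
by move=> u _; exact: depends_on_degree.
Qed.

(** Success of candidate [i] depends only on the edges between [phi i] and the
complement of [W]; these edge sets are disjoint for distinct [i], which is why
the vertices of [W] are left out here. *)
Lemma prob_no_low_degree (R : realFieldType) (V I L : finType) (p : R)
    (phi : I -> L -> V) (W : {set V}) (k : nat) :
  0 <= p <= 1 -> (forall i i' l l', phi i l = phi i' l' -> i = i' /\ l = l') ->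
  (forall i l, phi i l \in W) ->
  (2 ^ #|L|)%:R * p ^+ k <= 1 ->
  prob (pairs V) p (fun G => [forall i in I, ~~
    [forall u in ~: W, (#|[set l | [set u; phi i l] \in G]| < k)%N]]) <=
  (1 - (1 - (2 ^ #|L|)%:R * p ^+ k) ^+ #|V|) ^+ #|I|.
Proof.
move=> p01 phi_inj phiW x1.
rewrite (@prob_forall_indep _ _ _ _ _ _
  (fun i => \bigcup_(u in ~: W) star u [set phi i l | l in L])).
- rewrite -prodr_const.
  apply: ler_prod => i _; rewrite prob_ge0 //= probC lerB //.
  apply: prob_low_degree => //; first by move=> l l' /phi_inj[].
  by apply/subsetP => _ /codomP[l ->].
- move=> i i' _ _ ii'; apply/bigcup_disjointP => v; rewrite inE => vW.
  rewrite disjoint_sym; apply/bigcup_disjointP => u _.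
  apply: star_disjoint.
    by apply: contra vW => /imsetP[l _ ->].
  right; rewrite -setI_eq0; apply/set0Pn => -[x].
  rewrite inE => /andP[/imsetP[l _ ->] /imsetP[l' _ /phi_inj[e _]]].
  by rewrite e eqxx in ii'.
- move=> i _; apply: depends_onN; apply: depends_on_forall => u uW.
  apply: (@depends_onS _ _ (star u [set phi i l | l in L])).
    exact: (bigcup_sup u).
  exact: depends_on_degree.
Qed.

Lemma prob_not_independent (R : realFieldType) (V X : finType) (p : R) (phi : X -> V) :
  0 <= p <= 1 ->
  prob (pairs V) p (fun G => [exists x, [exists y, [set phi x; phi y] \in G]]) <=
  #|X|%:R ^+ 2 * p.
Proof.
move=> p01; case/andP: (p01) => p0 _.
apply: (@le_trans _ _ (prob (pairs V) p (fun G =>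
    [exists xy in {: X * X}, [set phi xy.1; phi xy.2] \in G]))).
  apply: prob_le => // G _ /existsP[x /existsP[y xyG]].
  by apply/existsP; exists (x, y).
apply: le_trans (prob_union _ _ _ p01) _.
apply: (@le_trans _ _ (\sum_(xy in {: X * X}) p)); last first.
  by rewrite sumr_const -[leLHS]mulr_natl card_prod natrM expr2.
apply: ler_sum => -[x y] _ /=.
have [xy|xy] := boolP ([set phi x; phi y] \in pairs V); first by rewrite prob_mem.
rewrite /prob (@eq_expect _ _ _ _ _ (fun=> 0 * 1)).
  by rewrite expectZ mul0r.
move=> G /subsetP sG; rewrite mul0r; case: (boolP (_ \in G)) => // /sG.
by rewrite (negbTE xy).
Qed.

Lemma label_inhabited (s : nat) : (0 < #|label s|)%N.
Proof.
have [|P [b [okP _]]] := @label_escape s set0; first by rewrite cards0.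
by apply/card_gt0P; exists (exist _ (b, P, ord0) (okP ord0)).
Qed.

(** If the union of the candidates is independent and candidate [i] has no
outside vertex of degree ['C(s, s./2)] into it, then candidate [i] carries the
gadget, and the other candidates provide the vertices without neighbour in it. *)
Lemma prob_tc_gt (R : realFieldType) (V I : finType) (s : nat) (p : R)
    (phi : I * label s -> V) :
  0 <= p <= 1 -> injective phi -> (s.+2 < #|I|)%N ->
  let m := #|label s| in let x := (2 ^ m)%:R * p ^+ 'C(s, s./2) in
  x <= 1 ->
  1 - (#|I| * m)%:R ^+ 2 * p - (1 - (1 - x) ^+ #|V|) ^+ #|I| <=
  prob (pairs V) p (fun G => (s.+1 < tc s.+1 G)%N).
Proof.
move=> p01 phi_inj cI m x x1.
pose W := [set phi y | y in {: I * label s}].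
have hphi i i' l l' : phi (i, l) = phi (i', l') -> i = i' /\ l = l'.
  by move=> /phi_inj[].
have phiW i l : phi (i, l) \in W by exact: imset_f.
pose dep (G : {set {set V}}) := [exists y, [exists y', [set phi y; phi y'] \in G]].
pose bad (G : {set {set V}}) := [forall i in I, ~~
    [forall u in ~: W, (#|[set l | [set u; phi (i, l)] \in G]| < 'C(s, s./2))%N]].
have pdep : prob (pairs V) p dep <= (#|I| * m)%:R ^+ 2 * p.
  by rewrite -card_prod; exact: prob_not_independent.
have pbad : prob (pairs V) p bad <= (1 - (1 - x) ^+ #|V|) ^+ #|I|.
  exact: prob_no_low_degree.
suff h : prob (pairs V) p (fun G => ~~ (s.+1 < tc s.+1 G)%N) <=
         prob (pairs V) p dep + prob (pairs V) p bad.
  move: h; rewrite probC; lra.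
rewrite /prob -expectD; apply: le_expect => // G _.
case: (boolP (dep G)) => [_|/existsPn indep].
  by move: (ler0n R (bad G)); case: (~~ _) => /=; lra.
case: (boolP (bad G)) => [_|]; first by case: (~~ _); rewrite ?add0r.
rewrite negb_forall_in => /exists_inP[i _]; rewrite negbK => /forall_inP low.
suff -> : (s.+1 < tc s.+1 G)%N by rewrite addr0.
have {}indep y y' : [set phi y; phi y'] \notin G by have /existsPn := indep y.
apply/tc_gtP.
have [l0 _] := card_gt0P (label_inhabited s).
pose Z := [set phi (i', l0) | i' in ~: [set i]].
apply: (@sparse_gadget_not_coverable V s G (fun l => phi (i, l)) Z).
- by move=> l l' /hphi[].
- by move=> l l'; exact: indep.
- move=> u uphi; have [|uW] := boolP (u \in W); last by apply: low; rewrite inE.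
  case/imsetP=> y _ ->; rewrite (_ : [set l | _] = set0) ?cards0 ?bin_gt0; last first.
    by apply/setP => l; rewrite !inE (negbTE (indep _ _)).
  lia.
- rewrite card_imset; last by move=> a b /hphi[].
  by move: cI; rewrite -(cardsC [set i]) cards1.
- move=> z /imsetP[i' ii' ->]; apply/codomP => -[l /hphi[e _]].
  by move: ii'; rewrite !inE e eqxx.
- by move=> z l /imsetP[i' _ ->]; exact: indep.
Qed.

(** * Binomial coefficients and integer roots *)

Lemma central_bin_rec (h : nat) :
  (h.+1 * 'C(h.+1.*2, h.+1) = 2 * (h.*2.+1 * 'C(h.*2, h)))%N.
Proof.
have e1 : (h.+1 * 'C(h.+1.*2, h.+1) = h.+1.*2 * 'C(h.*2.+1, h))%N.
  by rewrite -mul_bin_diag doubleS.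
have e2 : (h.+1 * 'C(h.*2.+1, h) = h.*2.+1 * 'C(h.*2, h))%N.
  rewrite (_ : 'C(h.*2.+1, h) = 'C(h.*2.+1, h.+1)); first by rewrite -mul_bin_diag.
  by rewrite -bin_sub; [congr 'C(_, _); lia | lia].
by rewrite e1 -e2; lia.
Qed.

(** The factor [16 (h + 3/2)^2 / ((h + 1) (h + 2))] by which the right-hand side
grows exceeds 16. *)
Lemma central_bin_ge (h : nat) :
  (16 ^ h.+1 <= 4 * h.+1 * 'C(h.+1.*2, h.+1) ^ 2)%N.
Proof.
elim: h => [|h IH]; first by [].
rewrite -(leq_pmul2l (ltn0Sn h.+1)); have e := central_bin_rec h.+1.
rewrite expnS; set A := (16 ^ h.+1)%N in IH *; set x := 'C(h.+1.*2, _) in IH e.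
set y := 'C(_, _) in e *; rewrite -mul2n in e.
have -> : (h.+2 * (4 * h.+2 * y ^ 2) = 4 * (h.+2 * y) ^ 2)%N by ring.
rewrite e.
have -> : (4 * (2 * ((2 * h.+1).+1 * x)) ^ 2 = 16 * ((2 * h.+1).+1 ^ 2 * x ^ 2))%N by ring.
have -> : (h.+2 * (16 * A) = 16 * (h.+2 * A))%N by ring.
rewrite leq_mul2l /=; apply: leq_trans (leq_mul (leqnn h.+2) IH) _.
rewrite mulnA leq_mul2r; apply/orP; right; lia.
Qed.

Lemma middle_bin_ge (s : nat) : (4 ^ s.+1 <= 16 * 'C(s, s./2) ^ 2 * s.+1)%N.
Proof.
have pow h : (4 ^ h.*2 = 16 ^ h)%N by rewrite -mul2n expnM.
rewrite -[s in (4 ^ s.+1)%N]odd_double_half -[s in 'C(s, _)]odd_double_half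
  -[s in (_ * s.+1)%N]odd_double_half.
set h := s./2; case: (odd s) => /=.
- rewrite add1n -doubleS pow; have := central_bin_ge h.
  have -> : 'C(h.+1.*2, h.+1) = (2 * 'C(h.*2.+1, h))%N.
    rewrite doubleS binS (_ : 'C(h.*2.+1, h.+1) = 'C(h.*2.+1, h)); first by lia.
    by rewrite -bin_sub; [congr 'C(_, _); lia | lia].
  by move=> /leq_trans; apply; lia.
- rewrite add0n expnS pow; case: h => [|h] //.
  have := central_bin_ge h; set x := 'C(_, _); set A := (16 ^ h.+1)%N => le.
  by rewrite (leq_trans (leq_mul (leqnn 4) le)) //; lia.
Qed.

Lemma nat_root_exists (K n : nat) : (0 < K)%N ->
  exists N, (N ^ K <= n < N.+1 ^ K)%N.
Proof.
move=> K0; elim: n => [|n [N /andP[le lt]]]; first by exists 0%N; rewrite exp0n // exp1n.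
have [lt'|ge] := ltnP n.+1 (N.+1 ^ K).
  by exists N; rewrite lt' leqW.
by exists N.+1; rewrite ge (leq_ltn_trans lt) // ltn_exp2r.
Qed.

(** * Asymptotics *)

From mathcomp Require Import all_classical all_reals all_analysis.
Import numFieldNormedType.Exports.
Local Open Scope classical_set_scope.

Lemma gnp_probE (R : realType) (n : nat) (p : R) (A : pred {set {set 'I_n}}) :
  gnp_prob p A = prob (pairs 'I_n) p A.
Proof.
rewrite /gnp_prob /prob /expect big_mkcondr /=; apply: eq_bigr => G _.
by case: (A G); rewrite ?mul1r ?mul0r.
Qed.

Lemma whp_of_bound (R : realType) (p : nat -> R) (A : forall n, pred {set {set 'I_n}})
    (err : nat -> R) :
  (forall n, 0 <= p n <= 1) ->
  (err n @[n --> \oo] --> 0) ->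
  (\forall n \near \oo, 1 - err n <= prob (pairs 'I_n) (p n) (A n)) ->
  whp p A.
Proof.
move=> p01 err0 bnd; rewrite /whp.
apply: (@squeeze_cvgr _ _ _ _ (fun n => 1 - err n) (fun=> 1)).
- near=> n; rewrite gnp_probE; apply/andP; split; first by near: n.
  by rewrite -(probT (pairs 'I_n) (p n)); apply: prob_le.
- rewrite -[X in _ --> X]subr0; apply: cvgB => //; exact: cvg_cst.
- exact: cvg_cst.
Unshelve. all: by end_near. Qed.

Lemma expR_opp_ge (R : realType) (x : R) : 0 <= x <= 1 / 2 -> expR (- (2 * x)) <= 1 - x.
Proof.
move=> /andP[x0 x1]; rewrite expRN -div1r ler_pdivrMr ?expR_gt0 //.
have h := expR_ge1Dx (2 * x).
apply: le_trans (_ : (1 - x) * (1 + 2 * x) <= _); first by nra.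
by apply: ler_wpM2l => //; lra.
Qed.

Lemma expR_ge_sqr (R : realType) (x : R) : 0 <= x -> x ^+ 2 / 2 <= expR x.
Proof. by move=> x0; apply: le_trans (expR_ge1Dxn 1 x0); rewrite lerDr. Qed.

Lemma onem_exp_le (R : realType) (x : R) (n : nat) : x <= 1 -> (1 - x) ^+ n <= expR (- (n%:R * x)).
Proof.
move=> x1; rewrite -mulrN expRM_natl.
apply: lerXn2r; rewrite ?nnegrE ?subr_ge0 ?expR_ge0 //; exact: expR_ge1Dx.
Qed.

Lemma powR_root (R : realType) (a : R) (k : nat) : 0 <= a -> (0 < k)%N ->
  (a `^ (1 / k%:R)) ^+ k = a.
Proof.
move=> a0 k0; rewrite -powR_mulrn ?powR_ge0 // -powRrM div1r mulVf ?powRr1 //.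
by rewrite pnatr_eq0 -lt0n.
Qed.

(** With [C = 2 (K + 1)] and [n - K >= n / 2], the power is at most
[expR (- (K + 1) ln n)]. *)
Lemma tc_le_error (R : realType) (K n : nat) (p : R) :
  (0 < K)%N -> 0 <= p <= 1 -> (K.*2.+2 <= n)%N ->
  ((K.+1.*2)%:R * ln n%:R / n%:R) `^ (1 / K%:R) < p ->
  n%:R ^+ K * (1 - p ^+ K) ^+ (n - K) <= n%:R^-1 :> R.
Proof.
move=> K0 /andP[p0 p1] nK; set a := _ / n%:R => ap.
have n0 : 0 < n%:R :> R by rewrite ltr0n; lia.
have ln0 : 0 <= ln n%:R :> R by apply: ln_ge0; rewrite ler1n; lia.
have a0 : 0 <= a by rewrite divr_ge0 ?mulr_ge0.
have apK : a <= p ^+ K.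
  by rewrite -(powR_root a0 K0) lerXn2r ?nnegrE ?powR_ge0 // ltW.
have pK1 : p ^+ K <= 1 by apply: exprn_ile1.
apply: (@le_trans _ _ (n%:R ^+ K * expR (- ((n - K)%:R * p ^+ K)))).
  by apply: ler_wpM2l; [rewrite exprn_ge0 // ltW | exact: onem_exp_le].
have half : n%:R / 2 <= (n - K)%:R :> R.
  rewrite ler_pdivrMr // -natrM ler_nat; lia.
apply: (@le_trans _ _ (n%:R ^+ K * expR (- (ln n%:R *+ K.+1)))).
  apply: ler_wpM2l; first by rewrite exprn_ge0 // ltW.
  rewrite ler_expR lerN2.
  have -> : ln n%:R *+ K.+1 = n%:R / 2 * a :> R.
    rewrite /a -mul2n natrM -mulr_natl; field; exact: lt0r_neq0.
  by apply: ler_pM => //; rewrite divr_ge0 // ltW.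
rewrite -lnXn // expRN lnK ?posrE ?exprn_gt0 // exprS invfM mulrA mulrAC.
by rewrite divff ?mul1r // expf_neq0 // lt0r_neq0.
Qed.

(** For a base at most 1 a larger exponent gives a smaller power, and
[middle_bin_ge] compares the two exponents; the right-hand one can be undone by
an integer power. *)
Lemma powR_middle_bin (R : realType) (s : nat) (a : R) :
  0 < a <= 1 ->
  a `^ (Num.sqrt s.+1%:R / 2 ^ (s.+1%:Z - 2)) <= a `^ (1 / 'C(s, s./2)%:R).
Proof.
move=> a01; apply: ger_powR => //; set k := 'C(s, s./2).
have k0 : 0 < k%:R :> R by rewrite ltr0n bin_gt0; lia.
have -> : 2 ^ (s.+1%:Z - 2) = 2 ^+ s.+1 / 4 :> R.
  rewrite expfzDr // -exprnP; congr (_ * _).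
  by rewrite -exprnN -natrX.
rewrite ler_pdivlMr ?divr_gt0 ?exprn_gt0 // mulrC mul1r ler_pdivrMr //.
rewrite -(@ler_pXn2r _ 2) ?nnegrE ?mulr_ge0 ?divr_ge0 ?exprn_ge0 ?sqrtr_ge0 ?(ltW k0) //.
rewrite !exprMn sqr_sqrtr // -exprM mulnC exprM.
have := middle_bin_ge s; rewrite -/k -(ler_nat R) !natrM !natrX.
have -> : 2 ^+ 2 = 4 :> R by ring.
lra.
Qed.

(** Here [n] lies between [N ^ (8 * k)] and [N.+1 ^ (8 * k)].  As [ln n] is at
most [2 n ^ (1/2)], the bound on [p ^ k] is below [n ^ (-1/2)], so [p <= N ^ (-4)];
this beats the [(N * m) ^ 2] pairs inside the candidates.  The constant 32 makes the success
probability [(1 - x) ^ n] of a candidate at least [N.+1 ^ (-1/2)], so that [N]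
independent trials all fail with probability at most [8 / N]. *)
Lemma tc_gt_error (R : realType) (k m n N : nat) (p : R) :
  (0 < k)%N -> (1 <= N)%N -> (N ^ (8 * k) <= n < N.+1 ^ (8 * k))%N ->
  0 <= p <= 1 -> p ^+ k <= (32 * k%:R * 2 ^+ m)^-1 * ln n%:R / n%:R ->
  let x := (2 ^ m)%:R * p ^+ k in
  x <= 1 /\
  (N * m)%:R ^+ 2 * p + (1 - (1 - x) ^+ n) ^+ N <= (m%:R ^+ 2 + 8) / N%:R.
Proof.
move=> k0 N1 /andP[Nn nN] /andP[p0 p1] pk x.
have Np : 0 < N%:R :> R by rewrite ltr0n.
have kp : 1 <= k%:R :> R by rewrite ler1n.
have mp : 1 <= 2 ^+ m :> R by rewrite exprn_ege1 // ler1n.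
have n1 : (0 < n)%N by apply: leq_trans Nn; rewrite expn_gt0 N1.
have np : 0 < n%:R :> R by rewrite ltr0n.
have np1 : 1 <= n%:R :> R by rewrite ler1n.
have kp0 : 0 < k%:R :> R by rewrite ltr0n.
have mp0 : 0 < 2 ^+ m :> R by exact: exprn_gt0.
have kn0 : k%:R != 0 :> R by rewrite lt0r_neq0 // (lt_le_trans ltr01).
have mn0 : 2 ^+ m != 0 :> R by rewrite lt0r_neq0 // (lt_le_trans ltr01).
have nn0 : n%:R != 0 :> R by rewrite lt0r_neq0.
have Nn0 : N%:R != 0 :> R by rewrite lt0r_neq0.
set L : R := ln n%:R in pk.
have L0 : 0 <= L by exact: ln_ge0.
have Ln : L <= n%:R by apply/ltW/ln_sublinear.
have x0 : 0 <= x by rewrite mulr_ge0 // exprn_ge0.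
have xn : x * n%:R <= L / (32 * k%:R).
  rewrite /x natrX -ler_pdivlMr //; apply: le_trans (ler_wpM2l (le_trans ler01 mp) pk) _.
  rewrite le_eqVlt; apply/orP; left; apply/eqP; field.
  by rewrite kn0 mn0 nn0.
have xhalf : x <= 1 / 2.
  rewrite -(ler_pM2r np); apply: le_trans xn _.
  rewrite ler_pdivrMr ?mulr_gt0 //.
  have : 32 * n%:R <= 32 * k%:R * n%:R :> R by rewrite ler_pM2r // ler_peMr.
  by nra.
split; first by lra.
have LN : L <= (8 * k)%:R * ln N.+1%:R.
  rewrite mulr_natl -lnXn ?ltr0n // -natrX ler_ln ?posrE ?ltr0n ?ler_nat ?expn_gt0 //.
  exact: ltnW.
set q := (1 - x) ^+ n.
have q1 : q <= 1 by apply: exprn_ile1; lra.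
have q2 : N.+1%:R^-1 <= q ^+ 2.
  rewrite -[N.+1%:R]lnK ?posrE ?ltr0n // -expRN.
  apply: (@le_trans _ _ ((expR (- (2 * x)) ^+ n) ^+ 2)); last first.
    have x01 : 0 <= x <= 1 / 2 by rewrite x0.
    apply: lerXn2r; rewrite ?nnegrE ?exprn_ge0 ?expR_ge0 //; first by lra.
    apply: lerXn2r; rewrite ?nnegrE ?expR_ge0 //; first by lra.
    exact: expR_opp_ge.
  rewrite -exprM -expRM_natl ler_expR natrM.
  have : L / (32 * k%:R) <= ln N.+1%:R / 4.
    rewrite ler_pdivrMr ?mulr_gt0 //.
    by apply: le_trans LN _; rewrite natrM; nra.
  nra.
have q0 : 0 < q.
  rewrite lt_def exprn_ge0 ?andbT; last by lra.
  apply: contraTneq q2 => ->; rewrite expr0n /= -ltNge invr_gt0 ltr0n //.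
clearbody q.
have miss : (1 - q) ^+ N <= 8 / N%:R.
  apply: le_trans (onem_exp_le _ _) _ => //.
  have y0 : 0 < N%:R * q by exact: mulr_gt0.
  have := expR_ge_sqr (ltW y0) => h.
  rewrite expRN; apply: (@le_trans _ _ (((N%:R * q) ^+ 2 / 2)^-1)).
    by rewrite lef_pV2 ?posrE ?expR_gt0 // divr_gt0 ?exprn_gt0.
  rewrite invfM invrK exprMn invfM mulrAC ler_pdivlMr //.
  have iq : (q ^+ 2)^-1 <= 2 * N%:R.
    rewrite -[leRHS]invrK lef_pV2 ?posrE ?invr_gt0 ?exprn_gt0 ?mulr_gt0 //.
    apply: le_trans q2; rewrite lef_pV2 ?posrE ?mulr_gt0 // ?ltr0n //.
    by rewrite -natr1; have : 1 <= N%:R :> R by [rewrite ler1n]; lra.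
  rewrite expr2 invfM; set z := (q ^+ 2)^-1 in iq *; set Ni := N%:R^-1.
  have -> : Ni * Ni * 2 * z * N%:R = 2 * (z * Ni) :> R.
    by rewrite /Ni; field; exact: lt0r_neq0.
  have : z * Ni <= 2 by rewrite ler_pdivrMr.
  lra.
have pN : p <= N%:R ^- 4.
  have h2k : (0 < 2 * k)%N by rewrite muln_gt0.
  rewrite -(ler_pXn2r h2k) ?nnegrE ?invr_ge0 ?exprn_ge0 //.
  rewrite mulnC exprM.
  have p2 : (p ^+ k) ^+ 2 <= (L / n%:R / 2) ^+ 2.
    apply: lerXn2r; rewrite ?nnegrE ?exprn_ge0 ?divr_ge0 ?(ltW np) //.
    apply: le_trans pk _; rewrite -mulrA mulrC; apply: ler_wpM2l; first by rewrite divr_ge0 // ltW.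
    rewrite lef_pV2 ?posrE ?mulr_gt0 //; nra.
  apply: le_trans p2 _.
  have Lsq : L ^+ 2 / 2 <= n%:R by rewrite -[n%:R]lnK ?posrE //; exact: expR_ge_sqr.
  apply: (@le_trans _ _ (n%:R^-1)).
    rewrite !exprMn !exprVn ler_pdivrMr ?exprn_gt0 // ler_pdivrMr ?exprn_gt0 //.
    have -> : n%:R^-1 * 2 ^+ 2 * n%:R ^+ 2 = 4 * n%:R :> R by field; exact: lt0r_neq0.
    nra.
  rewrite exprVn -exprM (_ : (4 * (k * 2) = 8 * k)%N); last by ring.
  by rewrite lef_pV2 ?posrE ?exprn_gt0 // -natrX ler_nat.
have edges : (N * m)%:R ^+ 2 * p <= m%:R ^+ 2 / N%:R.
  rewrite natrM exprMn mulrAC mulrC; apply: ler_wpM2l; first exact: exprn_ge0.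
  apply: le_trans (ler_wpM2l (exprn_ge0 2 (ltW Np)) pN) _.
  have -> : N%:R ^+ 2 * N%:R ^- 4 = (N%:R * N%:R)^-1 :> R.
    by field; exact: lt0r_neq0.
  have N1r : 1 <= N%:R :> R by rewrite ler1n.
  by rewrite lef_pV2 ?posrE ?mulr_gt0 //; nra.
by rewrite mulrDl lerD.
Qed.

Lemma cvg_inv_natr (R : realType) (N : nat -> nat) :
  (N n @[n --> \oo] --> \oo) -> ((N n)%:R^-1 : R) @[n --> \oo] --> 0.
Proof.
move=> Noo; apply/cvgr0Pnorm_lt => e e0.
near=> n.
have NA : (Num.trunc e^-1 < N n)%N.
  near: n; have /cvgnyPge := Noo; exact.
have N0 : 0 < (N n)%:R :> R by rewrite ltr0n; apply: leq_ltn_trans NA.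
rewrite ger0_norm ?invr_ge0 ?ler0n // invf_plt ?posrE //.
apply: lt_le_trans (truncnS_gt _) _.
by rewrite ler_nat.
Unshelve. all: by end_near. Qed.

Lemma whp_tc_le (R : realType) (r : nat) (p : nat -> R) :
  (forall n, 0 <= p n <= 1) ->
  (\forall n \near \oo,
     p n > (((2 ^ r).+1.*2)%:R * ln n%:R / n%:R) `^ (1 / 2 ^+ r)) ->
  whp p (fun n G => (tc r G <= r)%N).
Proof.
move=> p01 hp.
apply: (@whp_of_bound _ _ _ (fun n => n%:R^-1)) => //.
  exact: cvg_inv_natr cvg_id.
near=> n.
have nK : ((2 ^ r).*2.+2 <= n)%N by near: n; exact: nbhs_infty_ge.
apply: le_trans (prob_tc_le _ _) => //; last first.
  by rewrite card_ord; lia.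
rewrite card_ord lerB // tc_le_error ?expn_gt0 //.
by rewrite natrX; near: n.
Unshelve. all: by end_near. Qed.

Lemma whp_tc_gt (R : realType) (s : nat) (p : nat -> R) :
  let k := 'C(s, s./2) in let m := #|label s| in
  (forall n, 0 <= p n <= 1) ->
  (\forall n \near \oo,
     p n < ((32 * k%:R * 2 ^+ m)^-1 * ln n%:R / n%:R) `^
           (Num.sqrt s.+1%:R / 2 ^ (s.+1%:Z - 2))) ->
  whp p (fun n G => (s.+1 < tc s.+1 G)%N).
Proof.
move=> k m p01 hp; set c := (_ * _)^-1 in hp.
have k0 : (0 < k)%N by rewrite bin_gt0; lia.
have e0 : (0 < 8 * k)%N by rewrite muln_gt0.
have /choice[N hN] := fun n => nat_root_exists n e0.
have Noo : N n @[n --> \oo] --> \oo.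
  apply/cvgnyPge => A; near=> n.
  have An : (A ^ (8 * k) <= n)%N by near: n; exact: nbhs_infty_ge.
  rewrite -ltnS -(ltn_exp2r _ _ e0); apply: leq_ltn_trans An _.
  by case/andP: (hN n).
apply: (@whp_of_bound _ _ _ (fun n => (m%:R ^+ 2 + 8) / (N n)%:R)) => //.
  rewrite -[X in _ --> X](mulr0 (m%:R ^+ 2 + 8)).
  by apply: cvgMr; exact: cvg_inv_natr.
near=> n.
have Nbig : (m + s + 3 <= N n)%N by near: n; have /cvgnyPge := Noo; exact.
have n2 : (2 <= n)%N by near: n; exact: nbhs_infty_ge.
have N1 : (1 <= N n)%N by lia.
have pn : p n < (c * ln n%:R / n%:R) `^ (Num.sqrt s.+1%:R / 2 ^ (s.+1%:Z - 2)) by near: n.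
have n0 : 0 < n%:R :> R by rewrite ltr0n; lia.
have k1 : 1 <= k%:R :> R by rewrite ler1n.
have m1 : 1 <= 2 ^+ m :> R by rewrite exprn_ege1 // ler1n.
have D1 : 1 <= 32 * k%:R * 2 ^+ m :> R by rewrite !mulr_ege1 // ler1n.
have D0 := lt_le_trans ltr01 D1.
have c0 : 0 < c by rewrite invr_gt0.
have c1 : c <= 1 by rewrite invf_le1.
have ln0 : 0 < ln n%:R :> R by apply: ln_gt0; rewrite ltr1n.
have lnn : ln n%:R < n%:R :> R by apply: ln_sublinear.
have a01 : 0 < c * ln n%:R / n%:R <= 1.
  rewrite divr_gt0 ?mulr_gt0 //= ler_pdivrMr // mul1r.
  exact: le_trans (ler_piMl (ltW ln0) c1) (ltW lnn).
have pk : p n ^+ k <= c * ln n%:R / n%:R.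
  have /andP[a0 _] := a01.
  rewrite -[leRHS](powR_root (ltW a0) k0); apply: lerXn2r.
  - by rewrite nnegrE; case/andP: (p01 n).
  - by rewrite nnegrE powR_ge0.
  - exact: le_trans (ltW pn) (powR_middle_bin s a01).
have [x1 err] := tc_gt_error k0 N1 (hN n) (p01 n) pk.
have cardle : (#|{: 'I_(N n) * label s}| <= n)%N.
  rewrite card_prod card_ord -/m; have /andP[Nn _] := hN n.
  apply: leq_trans Nn; apply: (@leq_trans (N n ^ 2)%N).
    by rewrite -mulnn leq_mul2l; apply/orP; right; move: Nbig; clear; lia.
  by rewrite leq_pexp2l //; move: k0; clear; lia.
pose phi (y : 'I_(N n) * label s) : 'I_n := widen_ord cardle (enum_rank y).
have phi_inj : injective phi.
  by move=> y y' /(congr1 val) /= /val_inj /enum_rank_inj.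
have := @prob_tc_gt R 'I_n 'I_(N n) s (p n) phi (p01 n) phi_inj.
rewrite !card_ord -/m -/k => /(_ _ x1) h.
apply: le_trans (h _); last by move: Nbig; clear; lia.
by rewrite -addrA -opprD lerB.
Unshelve. all: by end_near. Qed.

Theorem theorem1p2 (R : realType) (r : nat) (hr : (0 < r)%N) :
  exists c C : R, [/\ 0 < c, 0 < C &
    forall p : nat -> R, (forall n, 0 <= p n <= 1) ->
      ((\forall n \near \oo,
          p n < (c * ln n%:R / n%:R) `^ (Num.sqrt r%:R / 2 ^ (r%:Z - 2))) ->
        whp p (fun n G => (r < tc r G)%N)) /\
      ((\forall n \near \oo,
          p n > (C * ln n%:R / n%:R) `^ (1 / 2 ^+ r)) ->
        whp p (fun n G => (tc r G <= r)%N))].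
Proof.
case: r hr => // s _.
exists (32 * 'C(s, s./2)%:R * 2 ^+ #|label s|)^-1, ((2 ^ s.+1).+1.*2)%:R; split.
- by rewrite invr_gt0 !mulr_gt0 ?exprn_gt0 // ltr0n bin_gt0; lia.
- by rewrite ltr0n.
- by move=> p p01; split; [exact: whp_tc_gt | exact: whp_tc_le].
Qed.
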